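(* Consider the Kalman smoothing data and the block tridiagonal system $Cx=r$ described in the context, where $C=H^{\mathrm T}R^{-1}H+G^{\mathrm T}Q^{-1}G$ and $r=H^{\mathrm T}R^{-1}z+G^{\mathrm T}Q^{-1}\zeta$. When applied to $C$ and $r$, the forward block tridiagonal (FBT) algorithm is equivalent to the Rauch-Tung-Striebel (RTS) smoother; that is, the output $\{e_k\}_{k=1}^N$ of the FBT algorithm satisfies $e_k=x_{k|N}$ for every $k=1,\dots,N$, where $x_{k|N}$ is the RTS smoothed estimate.
   Context: **Data.** $N\ge 2$; $x_0\in\mathbb{R}^n$; $G_k\in\mathbb{R}^{n\times n}$ ($k=2,\dots,N$), $H_k\in\mathbb{R}^{m(k)\times n}$, $z_k\in\mathbb{R}^{m(k)}$, and symmetric positive definite $Q_k\in\mathbb{R}^{n\times n}$, $R_k\in\mathbb{R}^{m(k)\times m(k)}$ ($k=1,\dots,N$). These come from the linear Gaussian model $x_1=x_0+w_1$, $x_k=G_kx_{k-1}+w_k$ ($k\ge2$), $z_k=H_kx_k+v_k$, with $w_k,v_k$ independent zero-mean Gaussian with covariances $Q_k,R_k$. **System.** $Q,R,H$ are the block diagonal matrices with blocks $Q_k,R_k,H_k$; $G$ is block lower bidiagonal with identity diagonal blocks and $-G_k$ in block position $(k,k-1)$; $z=(z_1,\dots,z_N)$ and $\zeta=(x_0,0,\dots,0)$ stacked. Then $C$ is symmetric positive definite and block tridiagonal, with diagonal blocks $b_k=Q_k^{-1}+G_{k+1}^{\mathrm T}Q_{k+1}^{-1}G_{k+1}+H_k^{\mathrm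 T}R_k^{-1}H_k$ (the term with index $N+1$ is zero), blocks $c_k=-Q_k^{-1}G_k$ in position $(k,k-1)$ and $c_k^{\mathrm T}$ in position $(k-1,k)$, $k=2,\dots,N$. Write $r_k$ for the blocks of $r$. **FBT algorithm.** Set $d_1^f=b_1$, $s_1^f=r_1$; for $k=2,\dots,N$ set $d_k^f=b_k-c_k(d_{k-1}^f)^{-1}c_k^{\mathrm T}$ and $s_k^f=r_k-c_k(d_{k-1}^f)^{-1}s_{k-1}^f$. Then set $e_N=(d_N^f)^{-1}s_N^f$ and, for $k=N-1,\dots,1$, $e_k=(d_k^f)^{-1}(s_k^f-c_{k+1}^{\mathrm T}e_{k+1})$. **RTS smoother.** Forward Kalman filter: $P_{1|0}=Q_1$, $x_{1|0}=x_0$; for $k\ge2$, $P_{k|k-1}=G_kP_{k-1|k-1}G_k^{\mathrm T}+Q_k$ and $x_{k|k-1}=G_kx_{k-1|k-1}$; for $k\ge1$, $P_{k|k}^{-1}=P_{k|k-1}^{-1}+H_k^{\mathrm T}R_k^{-1}H_k$ and $P_{k|k}^{-1}x_{k|k}=P_{k|k-1}^{-1}x_{k|k-1}+H_k^{\mathrm T}R_k^{-1}z_k$. Backward pass: starting from the filter estimate $x_{N|N}$, for $k=N-1,\dots,1$, $$x_{k|N}=x_{k|k}+C_k\,(x_{k+1|N}-G_{k+1}x_{k|k}),\qquad C_k=P_{k|k}G_{k+1}^{\mathrm T}P_{k+1|k}^{-1}.$$ *)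

(* Defs.v *)
From mathcomp Require Import all_boot all_order all_algebra.
From mathcomp Require Import reals.
Set Implicit Arguments.
Unset Strict Implicit.
Unset Printing Implicit Defensive.
Import Order.TTheory GRing.Theory Num.Theory.
Local Open Scope ring_scope.

(* Time indices are shifted by one: they run over 0, ..., N-1, index k standing
   for the k+1 of the 1-based convention.  Thus G k (used for 0 < k < N only)
   carries time k.-1 to time k, and "x_{k|N}" below is written with k < N.
   The data are families indexed by nat; values at indices outside this range
   are never used. *)

Definition spd_mx (K : realType) (n : nat) (A : 'M[K]_n) : Prop :=
  A^T = A /\ forall x : 'cV[K]_n, x != 0 -> 0 < (x^T *m A *m x) 0 0.

(* backward last step k is step k (step k.+1 (... (step (N - 2) last))), i.e.
   the value at k of the sequence equal to last at N - 1 and obtained from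
   there by descending recursion. *)
Definition backward (T : Type) (N : nat) (last : T) (step : nat -> T -> T)
    (k : nat) : T :=
  foldr step last (iota k (N.-1 - k)).

Lemma backward_last (T : Type) N (last : T) (step : nat -> T -> T) :
  backward N last step N.-1 = last.
Proof. by rewrite /backward subnn. Qed.

Lemma backward_step (T : Type) N (last : T) (step : nat -> T -> T) k :
  (k.+1 < N)%N ->
  backward N last step k = step k (backward N last step k.+1).
Proof. by case: N => // N ltkN; rewrite /backward /= -subSS subSn. Qed.

Section System.
Variables (K : realType) (N n : nat) (m : nat -> nat) (x0 : 'cV[K]_n).
Variables (G : nat -> 'M[K]_n) (H : forall k, 'M[K]_(m k, n)).
Variables (z : forall k, 'cV[K]_(m k)).
Variables (Q : nat -> 'M[K]_n) (R : forall k, 'M[K]_(m k)).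

Definition block_Q := \mxdiag_(i < N) Q i.
Definition block_R := \mxdiag_(i < N) R i.
Definition block_H := \mxblock_(i < N, j < N) (if i == j then H i else 0).
Definition block_G :=
  \mxblock_(i < N, j < N)
    (if i == j then 1%:M else if i == j.+1 :> nat then - G i else 0).
Definition block_z := \mxcol_(i < N) z i.
Definition block_zeta := \mxcol_(i < N) (if i == 0%N :> nat then x0 else 0).

Definition system_mx : 'M[K]_(\sum_(i < N) n) :=
  block_H^T *m invmx block_R *m block_H + block_G^T *m invmx block_Q *m block_G.

Definition system_rhs : 'cV[K]_(\sum_(i < N) n) :=
  block_H^T *m invmx block_R *m block_z
  + block_G^T *m invmx block_Q *m block_zeta.

End System.

(* The algorithm reads only the diagonal and subdiagonal blocks of C. *)
Section ForwardBlockTridiagonal.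
Variables (K : realType) (N n : nat).
Variables (C : 'M[K]_(\sum_(i < N) n)) (r : 'cV[K]_(\sum_(i < N) n)).

Definition blk (k l : nat) : 'M[K]_n :=
  match insub k, insub l with
  | Some i, Some j => @submxblock K N N (fun=> n) (fun=> n) C i j
  | _, _ => 0
  end.

Definition rhs_blk (k : nat) : 'cV[K]_n :=
  if insub k is Some i then @submxcol K N (fun=> n) 1 r i else 0.

Fixpoint fbt_d (k : nat) : 'M[K]_n :=
  if k is k'.+1 then
    blk k k - blk k k' *m invmx (fbt_d k') *m (blk k k')^T
  else blk 0 0.

Fixpoint fbt_s (k : nat) : 'cV[K]_n :=
  if k is k'.+1 then
    rhs_blk k - blk k k' *m invmx (fbt_d k') *m fbt_s k'
  else rhs_blk 0.

Definition fbt : nat -> 'cV[K]_n :=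
  backward N (invmx (fbt_d N.-1) *m fbt_s N.-1)
    (fun k e => invmx (fbt_d k) *m (fbt_s k - (blk k.+1 k)^T *m e)).

End ForwardBlockTridiagonal.

Section RauchTungStriebel.
Variables (K : realType) (N n : nat) (m : nat -> nat) (x0 : 'cV[K]_n).
Variables (G : nat -> 'M[K]_n) (H : forall k, 'M[K]_(m k, n)).
Variables (z : forall k, 'cV[K]_(m k)).
Variables (Q : nat -> 'M[K]_n) (R : forall k, 'M[K]_(m k)).

(* The measurement update in information form: filter_info k P is the inverse
   of P_{k|k} when P = P_{k|k-1}. *)
Definition filter_info (k : nat) (P : 'M[K]_n) : 'M[K]_n :=
  invmx P + (H k)^T *m invmx (R k) *m H k.

(* P_{k|k-1} *)
Fixpoint pred_cov (k : nat) : 'M[K]_n :=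
  if k is k'.+1 then
    G k *m invmx (filter_info k' (pred_cov k')) *m (G k)^T + Q k
  else Q 0.

(* P_{k|k} *)
Definition filt_cov (k : nat) : 'M[K]_n := invmx (filter_info k (pred_cov k)).

(* x_{k|k} in terms of x = x_{k|k-1} *)
Definition filter_update (k : nat) (x : 'cV[K]_n) : 'cV[K]_n :=
  filt_cov k *m (invmx (pred_cov k) *m x + (H k)^T *m invmx (R k) *m z k).

(* x_{k|k-1} *)
Fixpoint pred_mean (k : nat) : 'cV[K]_n :=
  if k is k'.+1 then G k *m filter_update k' (pred_mean k') else x0.

(* x_{k|k} *)
Definition filt_mean (k : nat) : 'cV[K]_n := filter_update k (pred_mean k).

Definition rts_gain (k : nat) : 'M[K]_n :=
  filt_cov k *m (G k.+1)^T *m invmx (pred_cov k.+1).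

(* x_{k|N} *)
Definition rts : nat -> 'cV[K]_n :=
  backward N (filt_mean N.-1)
    (fun k x => filt_mean k + rts_gain k *m (x - G k.+1 *m filt_mean k)).

End RauchTungStriebel.

(* Main.v *)
Require Import Defs.
From mathcomp Require Import all_boot all_order all_algebra.
From mathcomp Require Import reals.
Set Implicit Arguments.
Unset Strict Implicit.
Unset Printing Implicit Defensive.
Import Order.TTheory GRing.Theory Num.Theory.
Local Open Scope ring_scope.

(** Write [P] and [L] for the predicted covariance and the filtered information
    matrix (the inverse of the filtered covariance) at time [k], and
    [D = L + G^T Q^-1 G] with [G], [Q] taken at time [k.+1], the second term
    being dropped at the last time.  The forward sweep of the block algorithm
    is the Kalman filter in information form: its pivot is [D] and its
    right-hand side is the information vector [L x], where [x] is the filtered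
    mean ([fbt_dE], [fbt_sE]).  Both facts follow by induction from one
    push-through identity: if [M = G L^-1 G^T + Q] is the next predicted
    covariance, then [M Q^-1 G = G L^-1 D], so that [Q^-1 G D^-1 = M^-1 G L^-1]
    ([push_through_r]).  This rewrites the elimination multiplier, and makes
    the Schur complement update [Q^-1 - Q^-1 G D^-1 G^T Q^-1] equal to [M^-1]
    ([woodbury]).

    In the backward sweep, the mirror identity ([push_through_l]) says that
    [D^-1 G^T Q^-1] is the smoother gain [L^-1 G^T M^-1]; call it [J].  Since
    [D^-1 L = 1 - J G], the back substitution
    [D^-1 (L x + G^T Q^-1 e) = x + J (e - G x)] is exactly the smoother step
    ([back_substitution]).  All the inverses exist because the matrices
    involved are symmetric positive definite: each is the sum of such a matrix,
    or of the inverse of one, and of terms [B A B^T] with [A] positive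
    semidefinite. *)

(** * Positive definite matrices *)

Section Positivity.
Variable K : realType.

Definition psd_mx (n : nat) (A : 'M[K]_n) : Prop :=
  A^T = A /\ forall x : 'cV[K]_n, 0 <= (x^T *m A *m x) 0 0.

Lemma spd_psd n (A : 'M[K]_n) : spd_mx A -> psd_mx A.
Proof.
case=> symA posA; split=> // x.
have [->|/posA/ltW //] := eqVneq x 0.
by rewrite mulmx0 mxE.
Qed.

(** A kernel vector would make the quadratic form vanish. *)
Lemma spd_unitmx n (A : 'M[K]_n) : spd_mx A -> A \in unitmx.
Proof.
case=> symA posA; rewrite -row_free_unit; apply: inj_row_free => v vA0.
apply/eqP; apply: contraT => nz_v.
have := posA v^T; rewrite trmxK vA0 mul0mx mxE ltxx; apply.
by apply: contra nz_v => /eqP vT0; rewrite -[v]trmxK vT0 trmx0.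
Qed.

Lemma spd_inv n (A : 'M[K]_n) : spd_mx A -> spd_mx (invmx A).
Proof.
move=> spdA; have uA := spd_unitmx spdA; case: spdA => symA posA.
have symV : (invmx A)^T = invmx A by rewrite trmx_inv symA.
split=> // x nz_x.
have -> : x^T *m invmx A *m x = (invmx A *m x)^T *m A *m (invmx A *m x).
  by rewrite trmx_mul symV !mulmxA mulmxKV.
apply: posA; apply: contra nz_x => /eqP Vx0.
by rewrite -[x](mulKVmx uA) Vx0 mulmx0.
Qed.

Lemma psd_congr n p (A : 'M[K]_n) (B : 'M[K]_(p, n)) :
  psd_mx A -> psd_mx (B *m A *m B^T).
Proof.
case=> symA posA; split=> [|x].
  by rewrite !trmx_mul trmxK symA mulmxA.
by have := posA (B^T *m x); rewrite trmx_mul trmxK !mulmxA.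
Qed.

Lemma psd_congr_tr n p (A : 'M[K]_n) (B : 'M[K]_(n, p)) :
  psd_mx A -> psd_mx (B^T *m A *m B).
Proof. by move/(psd_congr B^T); rewrite trmxK. Qed.

Lemma spdDl n (A B : 'M[K]_n) : spd_mx A -> psd_mx B -> spd_mx (A + B).
Proof.
case=> symA posA [symB posB]; split=> [|x nz_x].
  by rewrite linearD /= symA symB.
by rewrite mulmxDr mulmxDl mxE ltr_wpDr // posA.
Qed.

End Positivity.

(** * The push-through identities *)

Section PushThrough.
Variables (K : comUnitRingType) (n : nat) (L Q G : 'M[K]_n).
Let M := G *m invmx L *m G^T + Q.
Let D := L + G^T *m invmx Q *m G.
Hypotheses (uL : L \in unitmx) (uQ : Q \in unitmx).
Hypotheses (uM : M \in unitmx) (uD : D \in unitmx).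

(** Both sides, multiplied by [M] and [D], expand to
    [G L^-1 G^T Q^-1 G + G]. *)
Lemma push_through_r :
  invmx Q *m G *m invmx D = invmx M *m G *m invmx L.
Proof.
have eqMD : M *m invmx Q *m G = G *m invmx L *m D.
  by rewrite mulmxDl mulmxDl mulmxDr mulmxV // mulmxKV // mul1mx !mulmxA addrC.
rewrite -[LHS](mulKmx uM) -!mulmxA; congr (_ *m _).
by rewrite !mulmxA eqMD mulmxK.
Qed.

Lemma push_through_l :
  invmx D *m G^T *m invmx Q = invmx L *m G^T *m invmx M.
Proof.
have eqDM : D *m invmx L *m G^T = G^T *m invmx Q *m M.
  by rewrite mulmxDl mulmxDl mulmxDr mulmxV // mulmxKV // mul1mx !mulmxA addrC.
rewrite -[LHS](mulmxK uM); congr (_ *m _).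
by rewrite -!mulmxA [G^T *m _]mulmxA -eqDM -!mulmxA mulKmx.
Qed.

Lemma woodbury :
  invmx Q - invmx Q *m G *m invmx D *m G^T *m invmx Q = invmx M.
Proof.
rewrite push_through_r.
have -> : invmx M *m G *m invmx L *m G^T = 1%:M - invmx M *m Q.
  by rewrite -(mulVmx uM) -mulmxBr addrK !mulmxA.
by rewrite mulmxBl mul1mx mulmxK // opprB addrC subrK.
Qed.

Lemma back_substitution (x e : 'cV[K]_n) :
  invmx D *m (L *m x + G^T *m invmx Q *m e)
  = x + invmx L *m G^T *m invmx M *m (e - G *m x).
Proof.
have DL : invmx D *m L = 1%:M - invmx L *m G^T *m invmx M *m G.
  by rewrite -push_through_l -(mulVmx uD) -!mulmxA -mulmxBr !mulmxA addrK.
rewrite mulmxDr !mulmxA DL push_through_l mulmxBl mul1mx mulmxBr !mulmxA.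
by rewrite -addrA [- _ + _]addrC.
Qed.

End PushThrough.

(** * The blocks of the system *)

Section Blocks.
Variable K : comUnitRingType.

Lemma invmx_mxdiag (N : nat) (p : 'I_N -> nat) (D : forall i, 'M[K]_(p i)) :
  (forall i, D i \in unitmx) ->
  invmx (\mxdiag_i D i) = \mxdiag_i invmx (D i).
Proof.
move=> uD.
have DV : (\mxdiag_i D i) *m (\mxdiag_i invmx (D i)) = 1%:M.
  rewrite {2}/mxdiag mul_mxdiag_mxblock -mxdiagZ; apply: eq_mxblock => i j.
  case: eqVneq => [<-|_]; last by rewrite mulmx0.
  by rewrite !conform_mx_id mulmxV.
by rewrite -[LHS]mulmx1 -DV mulKmx //; case: (mulmx1_unit DV).
Qed.

Lemma gram_mxblock (N N' : nat) (p : 'I_N -> nat) (q : 'I_N' -> nat)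
    (D : forall i, 'M[K]_(p i)) (B : forall i j, 'M[K]_(p i, q j)) :
  (forall i, D i \in unitmx) ->
  (\mxblock_(i, j) B i j)^T *m invmx (\mxdiag_i D i) *m \mxblock_(i, j) B i j
  = \mxblock_(i, j) \sum_k ((B k i)^T *m invmx (D k) *m B k j).
Proof.
by move=> uD; rewrite invmx_mxdiag // tr_mxblock mul_mxblock_mxdiag mul_mxblock.
Qed.

Lemma gram_mxcol (N N' : nat) (p : 'I_N -> nat) (q : 'I_N' -> nat)
    (D : forall i, 'M[K]_(p i)) (B : forall i j, 'M[K]_(p i, q j))
    (c : forall i, 'cV[K]_(p i)) :
  (forall i, D i \in unitmx) ->
  (\mxblock_(i, j) B i j)^T *m invmx (\mxdiag_i D i) *m \mxcol_i c i
  = \mxcol_i \sum_k ((B k i)^T *m invmx (D k) *m c k).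
Proof.
by move=> uD; rewrite invmx_mxdiag // tr_mxblock mul_mxblock_mxdiag
                      mul_mxblock_mxrow.
Qed.

End Blocks.

(** A column of a block lower bidiagonal matrix has at most two nonzero
    blocks, one in the last column. *)
Lemma sum_two_terms (V : nmodType) (N k : nat) (F : nat -> V) :
  (k < N)%N -> (forall i, i != k -> i != k.+1 -> F i = 0) ->
  \sum_(i < N) F i = F k + (if (k.+1 < N)%N then F k.+1 else 0).
Proof.
move=> ltkN F0; rewrite (bigD1 (Ordinal ltkN)) //=; congr (_ + _).
case: ifP => [ltSkN|geSkN].
  rewrite (bigD1 (Ordinal ltSkN)) /=; last by rewrite -val_eqE /= gtn_eqF.
  by rewrite big1 ?addr0 // => i /andP[nik nisk]; apply: F0.
rewrite big1 // => i nik; apply: F0 => //.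
by apply: contraFneq geSkN => <-.
Qed.

Section SystemBlocks.
Variables (K : realType) (N n : nat) (m : nat -> nat) (x0 : 'cV[K]_n).
Variables (G : nat -> 'M[K]_n) (H : forall k, 'M[K]_(m k, n)).
Variables (z : forall k, 'cV[K]_(m k)).
Variables (Q : nat -> 'M[K]_n) (R : forall k, 'M[K]_(m k)).
Hypothesis uQ : forall k, (k < N)%N -> Q k \in unitmx.
Hypothesis uR : forall k, (k < N)%N -> R k \in unitmx.

Let C := system_mx N G H Q R.
Let r := system_rhs N x0 G H z Q R.

Let Hb (i j : 'I_N) : 'M[K]_(m i, n) := if i == j then H i else 0.
Let Gb (i j : nat) : 'M[K]_n :=
  if i == j then 1%:M else if i == j.+1 then - G i else 0.

Lemma blk_system k l (ltkN : (k < N)%N) (ltlN : (l < N)%N) :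
  blk C k l
  = (if k == l then (H k)^T *m invmx (R k) *m H k else 0)
    + \sum_(i < N) ((Gb i k)^T *m invmx (Q i) *m Gb i l).
Proof.
rewrite /blk !insubT /C /system_mx /block_H /block_R /block_G /block_Q.
rewrite (gram_mxblock Hb) => [|i]; last exact: uR.
rewrite (gram_mxblock (fun i j : 'I_N => Gb i j)) => [|i]; last exact: uQ.
rewrite submxblockD !mxblockK; congr (_ + _).
rewrite (bigD1 (Ordinal ltkN)) //= big1 ?addr0 => [|i]; last first.
  by rewrite /Hb /= => /negPf ->; rewrite trmx0 !mul0mx.
rewrite /Hb eqxx -val_eqE /=; case: eqP => // _.
by rewrite mulmx0.
Qed.

Lemma rhs_blk_system k (ltkN : (k < N)%N) :
  rhs_blk r k
  = (H k)^T *m invmx (R k) *m z k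
    + \sum_(i < N) ((Gb i k)^T *m invmx (Q i) *m
                    (if i == 0%N :> nat then x0 else 0)).
Proof.
rewrite /rhs_blk insubT /r /system_rhs /block_H /block_R /block_G /block_Q.
rewrite /block_z /block_zeta.
rewrite (gram_mxcol Hb) => [|i]; last exact: uR.
rewrite (gram_mxcol (fun i j : 'I_N => Gb i j)) => [|i]; last exact: uQ.
rewrite submxcolD !mxcolK; congr (_ + _).
rewrite (bigD1 (Ordinal ltkN)) //= big1 ?addr0 => [|i]; last first.
  by rewrite /Hb /= => /negPf ->; rewrite trmx0 !mul0mx.
by rewrite /Hb eqxx.
Qed.

Lemma blk_diag k : (k < N)%N ->
  blk C k k
  = invmx (Q k) + (H k)^T *m invmx (R k) *m H k
    + (if (k.+1 < N)%N then (G k.+1)^T *m invmx (Q k.+1) *m G k.+1 else 0).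
Proof.
move=> ltkN; rewrite blk_system // eqxx.
rewrite (sum_two_terms (F := fun i => (Gb i k)^T *m invmx (Q i) *m Gb i k)
  ltkN) => [|i nik nisk]; last first.
  by rewrite /Gb (negPf nik) (negPf nisk) trmx0 !mul0mx.
rewrite /Gb eqxx trmx1 mul1mx mulmx1 addrA [_ + invmx _]addrC; congr (_ + _).
case: ifP => // _; rewrite gtn_eqF // eqxx.
by rewrite mulmxN [(- _)^T]linearN /= !mulNmx opprK.
Qed.

Lemma blk_subdiag k : (k.+1 < N)%N -> blk C k.+1 k = - (invmx (Q k.+1) *m G k.+1).
Proof.
move=> ltSkN; rewrite blk_system ?(ltnW ltSkN) // gtn_eqF // add0r.
rewrite (sum_two_terms (F := fun i => (Gb i k.+1)^T *m invmx (Q i) *m Gb i k)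
  (ltnW ltSkN)) => [|i nik nisk]; last first.
  by rewrite /Gb (negPf nik) (negPf nisk) mulmx0.
rewrite ltSkN /Gb !eqxx trmx1 mul1mx [k.+1 == k]gtn_eqF // [k == k.+1]ltn_eqF //.
by rewrite [k == k.+2]ltn_eqF // trmx0 !mul0mx add0r mulmxN.
Qed.

Lemma rhs_blk0 : (0 < N)%N ->
  rhs_blk r 0 = invmx (Q 0) *m x0 + (H 0)^T *m invmx (R 0) *m z 0.
Proof.
move=> N_gt0; rewrite rhs_blk_system // (bigD1 (Ordinal N_gt0)) //= big1.
  by rewrite /Gb eqxx trmx1 mul1mx addr0 addrC.
by move=> i; rewrite -val_eqE /= => /negPf ->; rewrite mulmx0.
Qed.

Lemma rhs_blkS k : (k.+1 < N)%N ->
  rhs_blk r k.+1 = (H k.+1)^T *m invmx (R k.+1) *m z k.+1.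
Proof.
move=> ltSkN; rewrite rhs_blk_system // big1 ?addr0 // => i _.
case: eqP => [-> | _]; last by rewrite mulmx0.
by rewrite /Gb /= trmx0 !mul0mx.
Qed.

End SystemBlocks.

(** * The two recursions *)

Section Equivalence.
Variables (K : realType) (N n : nat) (m : nat -> nat) (x0 : 'cV[K]_n).
Variables (G : nat -> 'M[K]_n) (H : forall k, 'M[K]_(m k, n)).
Variables (z : forall k, 'cV[K]_(m k)).
Variables (Q : nat -> 'M[K]_n) (R : forall k, 'M[K]_(m k)).
Hypothesis spdQ : forall k, (k < N)%N -> spd_mx (Q k).
Hypothesis spdR : forall k, (k < N)%N -> spd_mx (R k).

Let C := system_mx N G H Q R.
Let r := system_rhs N x0 G H z Q R.
Let P := pred_cov G H Q R.
Let L k := filter_info H R k (P k).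
Let D k := L k + (G k.+1)^T *m invmx (Q k.+1) *m G k.+1.

Let uQ k : (k < N)%N -> Q k \in unitmx.
Proof. by move/spdQ/spd_unitmx. Qed.
Let uR k : (k < N)%N -> R k \in unitmx.
Proof. by move/spdR/spd_unitmx. Qed.

Lemma spd_filter_info k (A : 'M[K]_n) :
  (k < N)%N -> spd_mx A -> spd_mx (filter_info H R k A).
Proof.
move=> ltkN spdA; apply: spdDl; first exact: spd_inv.
exact/psd_congr_tr/spd_psd/spd_inv/spdR.
Qed.

Lemma spd_pred_cov k : (k < N)%N -> spd_mx (P k).
Proof.
elim: k => [|k IHk] ltkN; first exact: spdQ.
rewrite /P /= addrC; apply: spdDl; first exact: spdQ.
apply/psd_congr/spd_psd/spd_inv/spd_filter_info; first exact: ltnW.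
exact/IHk/ltnW.
Qed.

Let spdL k : (k < N)%N -> spd_mx (L k).
Proof. by move=> ltkN; apply: spd_filter_info => //; apply: spd_pred_cov. Qed.

Let spdD k : (k.+1 < N)%N -> spd_mx (D k).
Proof.
move=> ltSkN; apply: spdDl; first exact/spdL/ltnW.
exact/psd_congr_tr/spd_psd/spd_inv/spdQ.
Qed.

Let uL k : (k < N)%N -> L k \in unitmx.
Proof. by move/spdL/spd_unitmx. Qed.
Let uP k : (k < N)%N -> P k \in unitmx.
Proof. by move/spd_pred_cov/spd_unitmx. Qed.
Let uD k : (k.+1 < N)%N -> D k \in unitmx.
Proof. by move/spdD/spd_unitmx. Qed.

Let blk_subdiag_tr k :
  (k.+1 < N)%N -> (blk C k.+1 k)^T = - ((G k.+1)^T *m invmx (Q k.+1)).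
Proof.
move=> ltSkN; rewrite blk_subdiag // linearN /= trmx_mul trmx_inv.
by case: (spdQ ltSkN) => ->.
Qed.

(** The pivots. The Schur complement replaces [invmx (Q k)] in the diagonal
    block by [invmx (P k)], by [woodbury]. *)
Lemma fbt_dE k : (k < N)%N -> fbt_d C k = if (k.+1 < N)%N then D k else L k.
Proof.
have LD j : L j + (if (j.+1 < N)%N then
      (G j.+1)^T *m invmx (Q j.+1) *m G j.+1 else 0)
    = if (j.+1 < N)%N then D j else L j.
  by case: ifP => // _; rewrite addr0.
elim: k => [|k IHk] ltkN; first by rewrite -LD /= blk_diag.
have dk : fbt_d C k = D k by rewrite IHk ?ltkN // ltnW.
rewrite -LD /= dk blk_subdiag_tr // blk_subdiag // blk_diag //.
have schur : invmx (Q k.+1) - invmx (Q k.+1) *m G k.+1 *m invmx (D k)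
            *m (G k.+1)^T *m invmx (Q k.+1) = invmx (P k.+1).
  by apply: woodbury; [exact/uL/ltnW | exact: uQ | exact: (uP ltkN) | exact: uD].
rewrite !mulNmx mulmxN opprK !mulmxA.
rewrite /L /filter_info -schur -!addrA; congr (_ + _).
by rewrite addrA addrC.
Qed.

(** The information vector that the filter update multiplies by the filtered
    covariance. *)
Lemma fbt_sE k : (k < N)%N ->
  fbt_s C r k = invmx (P k) *m pred_mean x0 G H z Q R k
                + (H k)^T *m invmx (R k) *m z k.
Proof.
elim: k => [|k IHk] ltkN; first by rewrite /= rhs_blk0.
have ltkN' := ltnW ltkN.
have filtE : filter_update G H z Q R k (pred_mean x0 G H z Q R k)
             = invmx (L k) *m fbt_s C r k by rewrite IHk.
rewrite /= filtE fbt_dE // ltkN rhs_blkS // blk_subdiag //.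
rewrite !mulNmx opprK addrC; congr (_ + _).
by rewrite [_ *m invmx (D k)]push_through_r ?uL ?uQ ?(uP ltkN) ?uD // !mulmxA.
Qed.

Lemma filt_meanE k : (k < N)%N ->
  filt_mean x0 G H z Q R k = invmx (L k) *m fbt_s C r k.
Proof. by move=> ltkN; rewrite fbt_sE. Qed.

Lemma fbt_d_unit k : (k < N)%N -> fbt_d C k \in unitmx.
Proof. by move=> ltkN; rewrite fbt_dE //; case: ifP => [/uD //|_]; apply: uL. Qed.

Lemma fbt_rts k : (k < N)%N -> fbt C r k = rts N x0 G H z Q R k.
Proof.
move=> ltkN; rewrite /fbt /rts.
have [j] := ubnP (N - k); elim: j k ltkN => // j IHj k ltkN ltNkj.
have [ltSkN|geSkN] := ltnP k.+1 N; last first.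
  have defN : N = k.+1 by apply/eqP; rewrite eqn_leq geSkN.
  have defk : N.-1 = k by rewrite defN.
  rewrite -defk !backward_last defk.
  by rewrite filt_meanE // fbt_dE // ltnNge geSkN.
have IH := IHj k.+1 ltSkN (leq_trans (ltn_sub2l ltkN (ltnSn k)) ltNkj).
rewrite [LHS](backward_step _ _ ltSkN) [RHS](backward_step _ _ ltSkN) IH.
set e := backward _ _ _ _.
rewrite filt_meanE // fbt_dE // ltSkN blk_subdiag_tr // mulNmx opprK.
rewrite -{1}[fbt_s C r k](mulKVmx (uL ltkN)).
by rewrite back_substitution ?uL ?uQ ?uD ?(uP ltSkN).
Qed.

Lemma unit_recursions k : (k < N)%N ->
  [/\ fbt_d C k \in unitmx, P k \in unitmx & L k \in unitmx].
Proof. by move=> ltkN; split; [apply: fbt_d_unit | apply: uP | apply: uL]. Qed.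

End Equivalence.

(* The first conjunct says that every matrix inverted by either recursion is
   invertible, so that no value of invmx on a singular matrix is involved. *)
Theorem mainTheorem4 (K : realType) (N n : nat) (m : nat -> nat)
    (x0 : 'cV[K]_n) (G : nat -> 'M[K]_n) (H : forall k : nat, 'M[K]_(m k, n))
    (z : forall k : nat, 'cV[K]_(m k))
    (Q : nat -> 'M[K]_n) (R : forall k : nat, 'M[K]_(m k))
    (hN : (2 <= N)%N)
    (hQ : forall k : nat, (k < N)%N -> spd_mx (Q k))
    (hR : forall k : nat, (k < N)%N -> spd_mx (R k)) :
  let C := system_mx N G H Q R in
  let r := system_rhs N x0 G H z Q R in
  (forall k : nat, (k < N)%N ->
     [/\ fbt_d C k \in unitmx,
         pred_cov G H Q R k \in unitmx &
         filter_info H R k (pred_cov G H Q R k) \in unitmx])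
  /\ (forall k : nat, (k < N)%N -> fbt C r k = rts N x0 G H z Q R k).
Proof.
move=> C r; split=> k ltkN; first exact: unit_recursions.
exact: fbt_rts.
Qed.
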